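(* Let $\mathcal{F}=\{f_1,\ldots,f_J\}$ be an iterated function system on $\mathbb{R}^d$. Let $U_0\subseteq\mathbb{R}^d$ be an open set which is nice with respect to $\mathcal{F}$, and assume that (1) $U_0$ is a finite union of disjoint open convex polytopes, and (2) each $f_j$ is an invertible affine transformation. Then there exist constants $W_0,L_0$ such that for all integers $k\ge 1$ there exists a sequence of functions $\psi_n\in\mathrm{NNF}_{W_0,\,L_0k+1}^{d\to 1}$ which converges to the indicator function $\chi_{U_k}$ of $U_k=H^kU_0$ pointwise and in $L^p(\mathcal{K})$ for all compact $\mathcal{K}\subseteq\mathbb{R}^d$ and all $1\le p<\infty$.
   Context: Iterated function system (IFS): a finite collection $\{f_1,\ldots,f_J\}$ of contractive mappings $f_j:\mathbb{R}^d\to\mathbb{R}^d$. Its Hutchinson operator is $H(A)=\bigcup_{j=1}^J f_jA$ for $A\subseteq\mathbb{R}^d$, where $f_jA$ denotes the image of $A$; $H^k$ is its $k$-fold iterate. Nice set: a bounded set $A\subseteq\mathbb{R}^d$ is nice with respect to $\{f_1,\ldots,f_J\}$ if $f_jA\subseteq A$ for all $j=1,\ldots,J$ and $f_iA\cap f_jA=\emptyset$ for all $i\ne j$. Neural network functions: $\mathrm{ReLU}$ acts on a vector coordinatewise by $t\mapsto\max(t,0)$. A neural network function (NNF) is a function of the form $f(x)=\eta_1\circ\eta_2\circ\cdots\circ\eta_{2q+1}(x)$, where $\eta_{2i-1}$ is an affine transformation for every $i=1,\ldots,q+1$ and $\eta_{2i}=\mathrm{ReLU}$ for every $i=1,\ldots,q$.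 The depth of such a representation is $q$, and its width is the maximal input or output dimension of all the $\eta_i$. Here $\mathrm{NNF}_{w,q}^{n_1\to n_2}$ is the family of functions $f:\mathbb{R}^{n_1}\to\mathbb{R}^{n_2}$ having such a representation with depth at most $q$ and width at most $w$. Indicator function: $\chi_A(x)=1$ if $x\in A$ and $\chi_A(x)=0$ if $x\notin A$. *)

(* Defs.v *)
From HB Require Import structures.
From mathcomp Require Import all_boot all_order all_algebra.
From mathcomp Require Import all_classical all_reals all_analysis measurable_realfun.

Set Implicit Arguments.
Unset Strict Implicit.
Unset Printing Implicit Defensive.

Import Order.TTheory GRing.Theory Num.Theory.
Import numFieldNormedType.Exports.

Local Open Scope classical_set_scope.
Local Open Scope ring_scope.

(* R^d is the type 'rV[R]_d of row vectors, so a linear map acts by right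
   multiplication x |-> x *m A. *)

Definition borel_rV (R : realType) (d : nat) : measurableType _ :=
  g_sigma_algebraType (@open 'rV[R]_d).

Definition rV_cons (R : realType) (d : nat)
    (p : measurableTypeR R * borel_rV R d) : borel_rV R d.+1 :=
  \row_i if unlift ord0 i is Some j then p.2 0 j else p.1.

Definition rV_uncons (R : realType) (d : nat) (v : borel_rV R d.+1) :
    measurableTypeR R * borel_rV R d :=
  (v 0 ord0, \row_j v 0 (lift ord0 j)).

Lemma sigma_finite_product d1 d2 (T1 : measurableType d1)
    (T2 : measurableType d2) (R : realType)
    (m1 : {sigma_finite_measure set T1 -> \bar R})
    (m2 : {sigma_finite_measure set T2 -> \bar R}) :
  sigma_finite setT (m1 \x m2)%E.
Proof.
have /sigma_finiteP[F [TF ndF Foo]] := sigma_finiteT m1.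
have /sigma_finiteP[G [TG ndG Goo]] := sigma_finiteT m2.
exists (fun n => F n `*` G n).
  rewrite -setXTT TF TG; apply/seteqP; split=> [[x y]|[x y] [n _ []]].
    move=> [/= [n _ Fnx] [k _ Gky]]; exists (maxn n k) => //; split.
    - by move: x Fnx; exact/subsetPset/ndF/leq_maxl.
    - by move: y Gky; exact/subsetPset/ndG/leq_maxr.
  by move=> ? ?; split; exists n.
move=> k; have [? ?] := Foo k; have [? ?] := Goo k.
split; first exact: measurableX.
by rewrite product_measure1E// lte_mul_pinfty// ge0_fin_numE.
Qed.

Section LebesgueMeasure.
Variable R : realType.

Lemma rV_consK d : cancel (@rV_cons R d) (@rV_uncons R d).
Proof.
move=> [x v]; rewrite /rV_uncons /rV_cons /= mxE unlift_none; congr pair.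
by apply/rowP => j; rewrite !mxE liftK.
Qed.

Lemma open_rV_bigcup_ball d (O : set 'rV[R]_d) : open O ->
  O = \bigcup_(q in [set q : 'rV[rat]_d * nat |
        ball (map_mx ratr q.1 : 'rV[R]_d) q.2.+1%:R^-1 `<=` O])
      ball (map_mx ratr q.1 : 'rV[R]_d) q.2.+1%:R^-1.
Proof.
move=> oO; apply/seteqP; split=> [x Ox|x [q /= qO]]; last exact: qO.
have /nbhs_ballP[e /= e0 xeO] := open_nbhs_nbhs (conj oO Ox).
have [k ke] : exists k : nat, k.+1%:R^-1 < e / 2.
  have e20 : 0 < e / 2 by rewrite divr_gt0.
  have := near_infty_natSinv_lt (PosNum e20).
  by case=> N _ /(_ N (leqnn N)) /=; exists N.
have k0 : 0 < k.+1%:R^-1 :> R by rewrite invr_gt0.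
have qex (i : 'I_d) : exists q : rat, ball (x 0 i) k.+1%:R^-1 (ratr q : R).
  have : x 0 i - k.+1%:R^-1 < x 0 i + k.+1%:R^-1 by rewrite ltrD2l gtrN.
  move=> /rat_in_itvoo[q]; rewrite in_itv /= => /andP[q1 q2].
  exists q; rewrite -ball_normE /= ltr_distlC.
  by rewrite q1.
have /choice[q qP] := qex.
have bxq : ball (map_mx ratr (\row_i q i) : 'rV[R]_d) k.+1%:R^-1 x.
  by split=> // i j; rewrite !mxE ord1; apply/ball_sym; exact: qP.
exists (\row_i q i, k) => //= y bqy; apply: xeO.
apply: (@le_ball _ _ x (k.+1%:R^-1 + k.+1%:R^-1)).
  by rewrite [leRHS](splitr e) lerD// ltW.
by apply: ball_triangle bqy; exact: ball_sym.
Qed.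

Lemma measurable_open_rV d (O : set 'rV[R]_d) :
  open O -> measurable (O : set (borel_rV R d)).
Proof. by move=> oO; exact: sub_gen_smallest. Qed.


Lemma measurable_fun_borel_rV d' (T : measurableType d') d
    (f : T -> borel_rV R d) :
  (forall O : set 'rV[R]_d, open O -> measurable (f @^-1` O)) ->
  measurable_fun [set: T] f.
Proof.
move=> mf; apply: (measurability (@open 'rV[R]_d : set (set (borel_rV R d)))) => // _ [U oU <-].
by rewrite setTI; exact: mf.
Qed.

Lemma measurable_rV_cons d : measurable_fun [set: _] (@rV_cons R d).
Proof.
apply: measurable_fun_borel_rV => O oO.
rewrite (open_rV_bigcup_ball oO) preimage_bigcup bigcup_mkcond.
apply: countable_bigcupT_measurable; first exact: countableP.
case=> q k; case: ifPn => // _.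
have k0 : 0 < k.+1%:R^-1 :> R by rewrite invr_gt0.
rewrite [X in measurable X](_ : _ =
  (ball (ratr (q 0 ord0) : R) k.+1%:R^-1 : set (measurableTypeR R)) `*`
  (ball (\row_j ratr (q 0 (lift ord0 j)) : 'rV[R]_d) k.+1%:R^-1 :
     set (borel_rV R d))).
  apply: measurableX; first exact: measurable_ball.
  by apply: measurable_open_rV; exact: ball_open.
apply/seteqP; split=> -[x v] /=.
  move=> [_ xv]; split; first by have := xv 0 ord0; rewrite !mxE unlift_none.
  split=> // i j; have := xv 0 (lift ord0 j).
  by rewrite !mxE liftK ord1.
move=> [qx [_ qv]]; split=> // i j; rewrite ord1 !mxE.
case: unliftP => [l ->|->] //.
by have := qv 0 l; rewrite !mxE.
Qed.

Lemma measurable_rV_uncons d : measurable_fun [set: _] (@rV_uncons R d).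
Proof.
apply: measurable_fun_pair.
  move=> _ A mA; rewrite setTI.
  have : measurable_fun setT
      (fun v : borel_rV R d.+1 => v 0 ord0 : measurableTypeR R).
    apply: (measurability _ (RGenOpens.measurableE R)).
    move=> _ [_ [a [b ->]] <-].
    rewrite setTI; apply: measurable_open_rV.
    by apply: open_comp; [move=> v _; exact: coord_continuous|exact: interval_open].
  by move=> /(_ measurableT A mA); rewrite setTI.
apply: measurable_fun_borel_rV => O oO; apply: measurable_open_rV.
apply: open_comp oO => v _ A [P vP PA].
exists (fun i l => if unlift ord0 l is Some j then P i j else setT) => [i l|w Pw].
  case: unliftP => [j ->|_]; last exact: filterT.
  by have := vP i j; rewrite mxE ord1.
apply: PA => i j; rewrite mxE; have := Pw i (lift ord0 j).
by rewrite liftK ord1.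
Qed.

Section rV_cons_measure.
Variables (d : nat) (mu : {sigma_finite_measure set (borel_rV R d) -> \bar R}).

Definition rV_cons_measure : set (borel_rV R d.+1) -> \bar R :=
  pushforward (lebesgue_measure \x mu)%E (@rV_cons R d).

HB.instance Definition _ :=
  isMeasurableFun.Build _ _ _ _ (@rV_cons R d) (@measurable_rV_cons d).

Let rV_cons_measure0 : rV_cons_measure set0 = 0%E.
Proof. exact: measure0. Qed.

Let rV_cons_measure_ge0 A : (0 <= rV_cons_measure A)%E.
Proof. exact: measure_ge0. Qed.

Let rV_cons_measure_sigma_additive : semi_sigma_additive rV_cons_measure.
Proof. exact: measure_semi_sigma_additive. Qed.

HB.instance Definition _ := isMeasure.Build _ _ _ rV_cons_measure
  rV_cons_measure0 rV_cons_measure_ge0 rV_cons_measure_sigma_additive.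

Let rV_cons_measure_sigma_finite : sigma_finite setT rV_cons_measure.
Proof.
have [F FT Foo] : sigma_finite setT (lebesgue_measure \x mu)%E.
  exact: sigma_finite_product.
exists (fun i => @rV_uncons R d @^-1` F i).
  by rewrite -preimage_bigcup -FT preimage_setT.
move=> i; have [mFi Fioo] := Foo i; split.
  by rewrite -[X in measurable X]setTI; exact: measurable_rV_uncons.
rewrite /rV_cons_measure /pushforward -comp_preimage.
by rewrite (_ : _ \o _ = id) ?preimage_id//; apply/funext; exact: rV_consK.
Qed.

HB.instance Definition _ := Measure_isSigmaFinite.Build _ _ _ rV_cons_measure
  rV_cons_measure_sigma_finite.

End rV_cons_measure.

(* d-dimensional Lebesgue measure on the Borel sets, as the d-fold product of
   the one-dimensional one; lebesgue_rV_box gives the volume of boxes. *)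
Fixpoint lebesgue_rV (d : nat) :
    {sigma_finite_measure set (borel_rV R d) -> \bar R} :=
  match d with
  | 0 => @dirac _ (borel_rV R 0) (0 : 'rV[R]_0) R
  | d'.+1 => rV_cons_measure (lebesgue_rV d')
  end.

Lemma lebesgue_rV_box d (a b : 'rV[R]_d) : (forall i, a 0 i <= b 0 i) ->
  lebesgue_rV d [set v : 'rV[R]_d | forall i, a 0 i < v 0 i < b 0 i] =
  (\prod_i (b 0 i - a 0 i))%:E.
Proof.
elim: d a b => [|d IH] a b ab.
  by rewrite big_ord0 /= diracE mem_set//= => -[].
set a' : 'rV[R]_d := \row_j a 0 (lift ord0 j).
set b' : 'rV[R]_d := \row_j b 0 (lift ord0 j).
rewrite [LHS](_ : _ = (lebesgue_measure \x lebesgue_rV d)%E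
   (`]a 0 ord0, b 0 ord0[%classic `*`
    [set v : 'rV[R]_d | forall i, a' 0 i < v 0 i < b' 0 i])); last first.
  apply: (congr1 (lebesgue_measure \x lebesgue_rV d)%E).
  apply/seteqP; split=> -[x v] /=.
    move=> xv; split.
      by have := xv ord0; rewrite mxE unlift_none in_itv.
    by move=> i; have := xv (lift ord0 i); rewrite !mxE liftK.
  move=> [xab vab] i; rewrite mxE; case: unliftP => [j ->|->].
    by have := vab j; rewrite !mxE.
  by move: xab; rewrite in_itv.
have mbox : measurable ([set v : 'rV[R]_d | forall i, a' 0 i < v 0 i < b' 0 i]
    : set (borel_rV R d)).
  rewrite (_ : [set v | _] = \bigcap_(i in [set: 'I_d])
      (fun v : 'rV[R]_d => v 0 i) @^-1` `]a' 0 i, b' 0 i[%classic).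
    apply: fin_bigcap_measurable => // i _; apply: measurable_open_rV.
    by apply: open_comp; [move=> v _; exact: coord_continuous
                         |exact: interval_open].
  apply/seteqP; split=> v /= vab; first by move=> i _; rewrite /= in_itv /=.
  by move=> i; have := vab i I; rewrite /= in_itv.
rewrite product_measure1E// IH; last by move=> i; rewrite !mxE.
rewrite [X in (X * _)%E]lebesgue_measure_itv /= lte_fin big_ord_recl.
under eq_bigr do rewrite !mxE.
case: ltP => [_|ba]; first by rewrite -EFinB -EFinM.
have -> : b 0 ord0 = a 0 ord0 by apply/eqP; rewrite eq_le ba ab.
by rewrite subrr mul0r mul0e.
Qed.

End LebesgueMeasure.

Section Affine.
Variable R : realType.

Definition affine n1 n2 (f : 'rV[R]_n1 -> 'rV[R]_n2) : Prop :=
  exists (A : 'M[R]_(n1, n2)) (b : 'rV[R]_n2), forall x, f x = x *m A + b.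

Definition invertible_affine d (f : 'rV[R]_d -> 'rV[R]_d) : Prop :=
  exists (A : 'M[R]_d) (b : 'rV[R]_d),
    A \in unitmx /\ forall x, f x = x *m A + b.

Definition open_halfspace d (H : set 'rV[R]_d) : Prop :=
  exists (a : 'cV[R]_d) (c : R),
    a != 0 /\ H = [set x | (x *m a) 0 0 < c].

(* Description by finitely many strict affine inequalities. *)
Definition open_polytope d (P : set 'rV[R]_d) : Prop :=
  bounded_set P /\
  exists (m : nat) (H : 'I_m -> set 'rV[R]_d),
    (forall i, open_halfspace (H i)) /\ P = \bigcap_i H i.

End Affine.

Section IFS.
Variables (R : realType) (d J : nat).
Implicit Types (f : 'I_J -> 'rV[R]_d -> 'rV[R]_d) (A : set 'rV[R]_d).

(* The library norm on 'rV[R]_d is the sup norm, for which being contractive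
   is a different condition. *)
Definition euclidean_norm (x : 'rV[R]_d) : R := Num.sqrt (\sum_i x 0 i ^+ 2).

Definition contractive (g : 'rV[R]_d -> 'rV[R]_d) : Prop :=
  exists2 c : R, 0 <= c < 1 &
    forall x y, euclidean_norm (g x - g y) <= c * euclidean_norm (x - y).

Definition ifs f : Prop := forall j, contractive (f j).

Definition hutchinson f A : set 'rV[R]_d := \bigcup_j (f j @` A).

Definition nice f A : Prop :=
  [/\ bounded_set A,
      forall j, f j @` A `<=` A &
      forall i j, i != j -> f i @` A `&` f j @` A = set0].

End IFS.

Section NNF.
Variable R : realType.

Definition relu n (x : 'rV[R]_n) : 'rV[R]_n := map_mx (Num.max^~ 0) x.

(* [nn_repr w q f]: f has a representation of depth exactly q and width at
   most w; the affine map applied first is split off. *)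
Fixpoint nn_repr (w q n1 n2 : nat) (f : 'rV[R]_n1 -> 'rV[R]_n2) : Prop :=
  match q with
  | 0 => [/\ (n1 <= w)%N, (n2 <= w)%N & affine f]
  | q'.+1 => exists (m : nat) (eta : 'rV[R]_n1 -> 'rV[R]_m)
                    (g : 'rV[R]_m -> 'rV[R]_n2),
      [/\ (n1 <= w)%N, (m <= w)%N, affine eta, nn_repr w q' g &
          f = g \o @relu m \o eta]
  end.

Definition NNF (w q n1 n2 : nat) : set ('rV[R]_n1 -> 'rV[R]_n2) :=
  [set f | exists2 q' : nat, (q' <= q)%N & nn_repr w q' f].

End NNF.

(* Convergence in L^p(K) includes membership of all functions in L^p(K);
   a function on K is extended by 0 to the whole space. *)
Definition cvg_Lp (R : realType) (d : nat) (K : set 'rV[R]_d) (p : R)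
    (u : nat -> 'rV[R]_d -> R) (f : 'rV[R]_d -> R) : Prop :=
  [/\ forall n, (u n \_ K : borel_rV R d -> R) \in Lfun (lebesgue_rV R d) p%:E,
      (f \_ K : borel_rV R d -> R) \in Lfun (lebesgue_rV R d) p%:E &
      'N[lebesgue_rV R d]_p%:E[EFin \o ((u n \- f)%R \_ K)]%E
        @[n --> \oo] --> 0%E].

(* Main.v *)
(* On U_1 the inverse branches glue to a map T, equal to f_j^-1 on f_j U_0, and
   x lies in U_k iff x, T x, ..., T^(k-1) x all lie in U_1.  The map T is affine
   on each of the finitely many disjoint open polytopes f_j P_i that make up
   U_1.  A block of three ReLU layers sends (x, c) to (T_n x, c + 1 - phi_n x),
   where phi_n vanishes off U_1 and increases to its indicator, and T_n x is
   eventually exactly T x for each x in U_1; the penalty c counts the failed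
   membership tests.  After k blocks, the output max (1 - c) 0 takes values in
   [0, 1] and is, for each x, eventually equal to the indicator of U_k, so that
   convergence in L^p(K) follows by dominated convergence. *)
Require Import Defs.
From mathcomp Require Import all_boot all_order all_algebra.
From mathcomp Require Import all_classical all_reals all_analysis.
From mathcomp Require Import measurable_realfun zify lra.

Set Implicit Arguments.
Unset Strict Implicit.
Unset Printing Implicit Defensive.

Import Order.TTheory GRing.Theory Num.Theory.
Import numFieldNormedType.Exports.

Local Open Scope classical_set_scope.
Local Open Scope ring_scope.

(** * Affine maps by coordinates, and networks precomposed with them *)

Section AffineForms.
Variable R : realType.

Definition affine_form n (g : 'rV[R]_n -> R) : Prop :=
  exists (a : 'cV[R]_n) (b : R), forall x, g x = (x *m a) 0 0 + b.

(** This lets the affinity of a layer be checked one unit at a time. *)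
Lemma affine_formP n m (f : 'rV[R]_n -> 'rV[R]_m) :
  affine f <-> forall j, affine_form (fun x => f x 0 j).
Proof.
split=> [[A [b fE]] j|faff].
  exists (col j A), (b 0 j) => x; rewrite fE !mxE; congr (_ + _).
  by apply: eq_bigr => i _; rewrite !mxE.
have /choice[a aP] := faff; have /choice[b bP] := aP.
exists (\matrix_(i, j) a j i 0), (\row_j b j) => x.
apply/rowP => j; rewrite bP !mxE; congr (_ + _).
by apply: eq_bigr => i _; rewrite !mxE.
Qed.

Lemma affine_form_cst n (c : R) : affine_form (fun _ : 'rV[R]_n => c).
Proof. by exists 0, c => x; rewrite mulmx0 mxE add0r. Qed.

Lemma affine_form_coord n i : affine_form (fun x : 'rV[R]_n => x 0 i).
Proof.
by exists (delta_mx i 0), 0 => x; rewrite -colE mxE addr0.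
Qed.

Lemma affine_formD n (g h : 'rV[R]_n -> R) :
  affine_form g -> affine_form h -> affine_form (fun x => g x + h x).
Proof.
move=> [a [b gE]] [a' [b' hE]]; exists (a + a'), (b + b') => x.
by rewrite gE hE mulmxDr [in RHS]mxE addrACA.
Qed.

Lemma affine_formZ n (c : R) (g : 'rV[R]_n -> R) :
  affine_form g -> affine_form (fun x => c * g x).
Proof.
move=> [a [b gE]]; exists (c *: a), (c * b) => x.
by rewrite gE mulrDr -scalemxAr [in RHS]mxE.
Qed.

Lemma affine_formN n (g : 'rV[R]_n -> R) :
  affine_form g -> affine_form (fun x => - g x).
Proof.
by move=> /(affine_formZ (-1)); under [in X in X -> _]eq_fun do rewrite mulN1r.
Qed.

Lemma affine_formB n (g h : 'rV[R]_n -> R) :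
  affine_form g -> affine_form h -> affine_form (fun x => g x - h x).
Proof. by move=> ag /affine_formN; exact: affine_formD. Qed.

Lemma affine_form_sum n (I : finType) (g : I -> 'rV[R]_n -> R) :
  (forall i, affine_form (g i)) -> affine_form (fun x => \sum_i g i x).
Proof.
move=> gaff; elim: (index_enum I) => [|i s IHs].
  under eq_fun do rewrite big_nil; exact: affine_form_cst.
by under eq_fun do rewrite big_cons; exact: affine_formD.
Qed.

Lemma affine_comp n1 n2 n3 (g : 'rV[R]_n2 -> 'rV[R]_n3)
    (f : 'rV[R]_n1 -> 'rV[R]_n2) :
  affine g -> affine f -> affine (g \o f).
Proof.
move=> [B [b gE]] [A [a fE]]; exists (A *m B), (a *m B + b) => x /=.
by rewrite gE fE mulmxDl mulmxA addrA.
Qed.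

Lemma affine_form_comp n1 n2 (g : 'rV[R]_n2 -> R)
    (f : 'rV[R]_n1 -> 'rV[R]_n2) :
  affine_form g -> affine f -> affine_form (fun x => g (f x)).
Proof.
move=> [a [b gE]] [A [c fE]]; exists (A *m a), ((c *m a) 0 0 + b) => x.
by rewrite gE fE mulmxDl mulmxA [in LHS]mxE addrA.
Qed.

(** The first affine layer absorbs [e], so the depth does not grow. *)
Lemma nn_repr_comp_affine w q n1 n2 n3 (g : 'rV[R]_n2 -> 'rV[R]_n3)
    (e : 'rV[R]_n1 -> 'rV[R]_n2) :
  (n1 <= w)%N -> affine e -> nn_repr w q g -> nn_repr w q (g \o e).
Proof.
case: q => [|q] n1w eaff /=.
  by move=> [_ ? gaff]; split => //; exact: affine_comp.
move=> [m [eta [g' [_ mw etaaff g'nn ->]]]].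
by exists m, (eta \o e), g'; split => //; exact: affine_comp.
Qed.

Lemma nn_repr_relu w q n1 n2 n3 (g : 'rV[R]_n2 -> 'rV[R]_n3)
    (e : 'rV[R]_n1 -> 'rV[R]_n2) :
  (n1 <= w)%N -> (n2 <= w)%N -> affine e -> nn_repr w q g ->
  nn_repr w q.+1 (g \o @relu R n2 \o e).
Proof. by move=> n1w n2w eaff gnn; exists n2, e, g. Qed.

End AffineForms.

(* Vectors indexed by an arbitrary finite type, which spares index arithmetic
   when the units of a layer are of several kinds. *)
Section IndexedVectors.
Variables (R : realType) (I : finType).

Definition vec_of (F : I -> R) : 'rV[R]_#|I| := \row_i F (enum_val i).

Definition entry (v : 'rV[R]_#|I|) (i : I) : R := v 0 (enum_rank i).

Lemma entry_vec_of F i : entry (vec_of F) i = F i.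
Proof. by rewrite /entry mxE enum_rankK. Qed.

Lemma entry_relu v i : entry (relu v) i = Num.max (entry v i) 0.
Proof. by rewrite /entry mxE. Qed.

Lemma entryP u v : entry u =1 entry v -> u = v.
Proof.
by move=> uv; apply/rowP => i; rewrite -(enum_valK i); exact: uv.
Qed.

Lemma affine_form_entry i : affine_form (entry^~ i).
Proof. exact: affine_form_coord. Qed.

Lemma affine_vec_of n (F : 'rV[R]_n -> I -> R) :
  (forall i, affine_form (F^~ i)) -> affine (fun x => vec_of (F x)).
Proof.
move=> Faff; apply/affine_formP => j.
by under eq_fun do rewrite mxE; exact: Faff.
Qed.

End IndexedVectors.

(** * A ReLU network that iterates a piecewise affine map *)

Section Network.
Variables (R : realType) (d : nat) (A : finType) (h : A -> nat).
Variables (l : forall a, 'I_(h a) -> 'rV[R]_d -> R).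
Variables (g : A -> 'rV[R]_d -> 'rV[R]_d).
Hypothesis l_affine : forall a i, affine_form (@l a i).
Hypothesis g_affine : forall a, affine (g a).

(** In the application [a] is a pair (j, i), [piece a] is f_j P_i, and [g a] is the inverse of
    f_j. *)
Let piece a := [set x | forall i, 0 < @l a i x].
Hypothesis piece_disj : forall a b x, piece a x -> piece b x -> a = b.

Let relu1 (t : R) := Num.max t 0.

(* A state is a point together with a penalty counting the failed membership
   tests. *)
Let state := #|{: option 'I_d}|.
Let mkstate (x : 'rV[R]_d) (c : R) : 'rV[R]_state :=
  vec_of (fun o => if o is Some i then x 0 i else c).
Let point (z : 'rV[R]_state) : 'rV[R]_d := \row_i entry z (Some i).
Let penalty (z : 'rV[R]_state) : R := entry z None.

Let point_mkstate x c : point (mkstate x c) = x.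
Proof. by apply/rowP => i; rewrite mxE entry_vec_of. Qed.

Let penalty_mkstate x c : penalty (mkstate x c) = c.
Proof. by rewrite /penalty entry_vec_of. Qed.

Let affine_point : affine point.
Proof.
apply/affine_formP => j; under eq_fun do rewrite mxE.
exact: affine_form_entry.
Qed.

(* Units ('I_d * bool) carry a coordinate through a ReLU as its positive part
   (false) and its negative part (true); the unit of type unit carries the
   penalty. *)
Let H1 : finType := ({a : A & 'I_(h a)} + ('I_d * bool + unit))%type.
Let H2 : finType := (A + ('I_d * bool + unit))%type.
Let H3 : finType := (A * ('I_d * bool) + unit)%type.

Let eta1 (n : nat) (z : 'rV[R]_state) : 'rV[R]_#|H1| :=
  vec_of (fun k : H1 => match k with
  | inl t => 1 - n%:R * l (tagged t) (point z)
  | inr (inl (i, b)) => (-1) ^+ b * entry z (Some i)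
  | inr (inr _) => entry z None
  end).

Let eta2 (v : 'rV[R]_#|H1|) : 'rV[R]_#|H2| :=
  vec_of (fun k : H2 => match k with
  | inl a =>
      1 - \sum_(i < h a) entry v (inl (Tagged (fun a => 'I_(h a)) i) : H1)
  | inr s => entry v (inr s : H1)
  end).

Let point2 (v : 'rV[R]_#|H2|) : 'rV[R]_d :=
  \row_i (entry v (inr (inl (i, false)) : H2) -
          entry v (inr (inl (i, true)) : H2)).

Let eta3 (n : nat) (v : 'rV[R]_#|H2|) : 'rV[R]_#|H3| :=
  vec_of (fun k : H3 => match k with
  | inl (a, (i, b)) => (-1) ^+ b * g a (point2 v) 0 i -
                       n%:R * (1 - entry v (inl a : H2))
  | inr _ => entry v (inr (inr tt) : H2) + 1 -
             \sum_a entry v (inl a : H2)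
  end).

Let eta4 (v : 'rV[R]_#|H3|) : 'rV[R]_state :=
  vec_of (fun k => match k with
  | Some i => \sum_a (entry v (inl (a, (i, false)) : H3) -
                      entry v (inl (a, (i, true)) : H3))
  | None => entry v (inr tt : H3)
  end).

Let affine_eta1 n : affine (eta1 n).
Proof.
apply: affine_vec_of => -[t|[[i b]|[]]].
- apply: affine_formB; first exact: affine_form_cst.
  by apply: affine_formZ; exact: affine_form_comp.
- by apply: affine_formZ; exact: affine_form_entry.
- exact: affine_form_entry.
Qed.

Let affine_eta2 : affine eta2.
Proof.
apply: affine_vec_of => -[a|s]; last exact: affine_form_entry.
apply: affine_formB; first exact: affine_form_cst.
by apply: affine_form_sum => i; exact: affine_form_entry.
Qed.

Let affine_point2 : affine point2.
Proof.
apply/affine_formP => j; under eq_fun do rewrite mxE.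
by apply: affine_formB; exact: affine_form_entry.
Qed.

Let affine_eta3 n : affine (eta3 n).
Proof.
apply: affine_vec_of => -[[a [i b]]|_].
- apply: affine_formB; apply: affine_formZ.
    by move/affine_formP : (affine_comp (g_affine a) affine_point2); exact.
  apply: affine_formB; first exact: affine_form_cst.
  exact: affine_form_entry.
- apply: affine_formB.
    by apply: affine_formD; [exact: affine_form_entry|exact: affine_form_cst].
  by apply: affine_form_sum => a; exact: affine_form_entry.
Qed.

Let affine_eta4 : affine eta4.
Proof.
apply: affine_vec_of => -[i|]; last exact: affine_form_entry.
by apply: affine_form_sum => a; apply: affine_formB; exact: affine_form_entry.
Qed.

(** The block ends with an affine map, which merges with the affine start of what follows; hence a
    block costs depth 3 only. *)
Let step n := eta4 \o @relu R _ \o eta3 n \o @relu R _ \o eta2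
  \o @relu R _ \o eta1 n.

(** An approximation from below to the indicator of [piece a]: a violated inequality contributes at
    least 1 to the sum, while one with [l i x >= 1 / n] contributes 0. *)
Let bump n a x := relu1 (1 - \sum_(i < h a) relu1 (1 - n%:R * l i x)).

(* For |y| <= n, the difference relu (y - n(1 - t)) - relu (- y - n(1 - t)) is
   y for t = 1 and 0 for t = 0: a gate replacing the product t y. *)
Let next n (x : 'rV[R]_d) : 'rV[R]_d := \row_i \sum_a
  (relu1 (g a x 0 i - n%:R * (1 - bump n a x)) -
   relu1 (- g a x 0 i - n%:R * (1 - bump n a x))).

Let relu1B t : relu1 t - relu1 (- t) = t.
Proof.
rewrite /relu1; case: (leP t 0) => t0.
  by rewrite max_l ?oppr_ge0// sub0r opprK.
by rewrite max_r ?oppr_le0 ?ltW// subr0.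
Qed.

Let point2E n z :
  point2 (relu (eta2 (relu (eta1 n z)))) = point z.
Proof.
apply/rowP => i; rewrite !mxE !(entry_relu, entry_vec_of) expr0 mul1r expr1.
(* Positive and negative parts are nonnegative, so the second ReLU leaves them unchanged. *)
rewrite mulN1r !(@max_l _ _ (Num.max _ 0) 0) ?le_max ?lexx ?orbT//.
exact: relu1B.
Qed.

Let bumpE n z a :
  entry (relu (eta2 (relu (eta1 n z)))) (inl a : H2) = bump n a (point z).
Proof.
rewrite entry_relu entry_vec_of; congr (relu1 (1 - _)).
by apply: eq_bigr => i _; rewrite entry_relu entry_vec_of.
Qed.

Let stepE n z : step n z = mkstate (next n (point z))
  (relu1 (relu1 (penalty z) + 1 - \sum_a bump n a (point z))).
Proof.
apply: entryP => -[i|]; rewrite !entry_vec_of.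
- rewrite mxE; apply: eq_bigr => a _.
  rewrite !(entry_relu (I := H3)) !entry_vec_of point2E bumpE.
  by rewrite expr0 mul1r expr1 mulN1r.
- rewrite entry_relu entry_vec_of; congr relu1.
  under eq_bigr do rewrite bumpE.
  rewrite !(entry_relu, entry_vec_of); congr (_ + _ - _).
  by rewrite max_l// le_max lexx orbT.
Qed.

Let relu1_ge0 t : 0 <= relu1 t.
Proof. by rewrite le_max lexx orbT. Qed.

Let relu1_id t : 0 <= t -> relu1 t = t.
Proof. exact: max_l. Qed.

Let relu1_eq0 t : t <= 0 -> relu1 t = 0.
Proof. exact: max_r. Qed.

Let bump_le1 n a x : bump n a x <= 1.
Proof.
by rewrite ge_max ler01 andbT gerBl; apply: sumr_ge0 => i _; exact: relu1_ge0.
Qed.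

Let bump_out n a x : ~ piece a x -> bump n a x = 0.
Proof.
move=> /existsNP[i /negP]; rewrite -leNgt => li0.
apply: relu1_eq0; rewrite subr_le0 (bigD1 i)//=.
apply: (@le_trans _ _ (relu1 (1 - n%:R * l i x))).
  by rewrite le_max lerBrDl gerDr mulr_ge0_le0// ler0n.
by rewrite lerDl; apply: sumr_ge0 => j _; exact: relu1_ge0.
Qed.

(** The inequalities are strict and finite in number, so one n exceeds all the [1 / l a i x]. *)
Let bump_in a x : piece a x -> \forall n \near \oo, bump n a x = 1.
Proof.
move=> Qx; have : \forall n \near \oo, forall i, 1 <= n%:R * @l a i x.
  apply: filter_forall => i; near=> n.
  rewrite -ler_pdivrMr; last exact: Qx.
  by near: n; exact: nbhs_infty_ger.
apply: filterS => n ln; rewrite /bump big1 ?subr0 ?relu1_id// => i _.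
by apply: relu1_eq0; rewrite subr_le0.
Unshelve. all: end_near. Qed.

Let sum_bump n a x : piece a x -> \sum_b bump n b x = bump n a x.
Proof.
move=> Qx; rewrite (bigD1 a)//= big1 ?addr0// => b ba.
by apply: bump_out => Qb; rewrite (piece_disj Qx Qb) eqxx in ba.
Qed.

Let sum_bump_out n x : (forall a, ~ piece a x) -> \sum_b bump n b x = 0.
Proof. by move=> Qx; apply: big1 => a _; exact/bump_out/Qx. Qed.

Let sum_bump_le1 n x : \sum_b bump n b x <= 1.
Proof.
have [[a Qx]|/forallNP Qx] := pselect (exists a, piece a x).
  by rewrite (sum_bump n Qx).
by rewrite sum_bump_out.
Qed.

(** Equality for large n, rather than mere convergence, lets the next block start from the exact
    image point, so no error propagates. *)
Let next_in a x : piece a x -> \forall n \near \oo, next n x = g a x.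
Proof.
move=> Qx.
(* The bound serves to close the gates of the pieces b other than a; the gate of a, with bump 1, is
   exact for any n. *)
have gn : \forall n \near \oo, forall b i, `|g b x 0 i| <= n%:R :> R.
  apply: filter_forall => b; apply: filter_forall => i.
  exact: nbhs_infty_ger.
near=> n; apply/rowP => i; rewrite mxE (bigD1 a)//= big1 => [|b ba].
  have -> : bump n a x = 1 by near: n; exact: bump_in.
  by rewrite subrr mulr0 !subr0 addr0 relu1B.
rewrite bump_out ?subr0 ?mulr1; last first.
  by move=> Qb; rewrite (piece_disj Qx Qb) eqxx in ba.
have : `|g b x 0 i| <= n%:R by move: b i {ba}; near: n.
rewrite ler_norml => /andP[gn1 gn2].
by rewrite !relu1_eq0 ?subrr// subr_le0// lerNl.
Unshelve. all: end_near. Qed.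

Let step_in a z : piece a (point z) -> 0 <= penalty z ->
  \forall n \near \oo, step n z = mkstate (g a (point z)) (penalty z).
Proof.
move=> Qz cz; near=> n; rewrite stepE (sum_bump n Qz).
have -> : bump n a (point z) = 1 by near: n; exact: bump_in.
have -> : next n (point z) = g a (point z) by near: n; exact: next_in.
by rewrite addrK (relu1_id cz) relu1_id.
Unshelve. all: end_near. Qed.

Let step_out n z : (forall a, ~ piece a (point z)) -> 1 <= penalty (step n z).
Proof.
move=> Qz; rewrite stepE penalty_mkstate sum_bump_out// subr0.
by rewrite le_max lerDr relu1_ge0.
Qed.

(** The pieces are disjoint, so the bumps sum to at most 1 and the increment is nonnegative: a
    failed test is never undone. *)
Let penalty_step n z : penalty z <= penalty (step n z).
Proof.
rewrite stepE penalty_mkstate; set s := \sum_a _.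
have s1 : s <= 1 by exact: sum_bump_le1.
rewrite le_max; apply/orP; left.
rewrite -addrA (@le_trans _ _ (relu1 (penalty z)))//.
  by rewrite le_max lexx.
by rewrite lerDl subr_ge0.
Qed.

(** Blocks are added on the input side, in line with the recursion of [nn_repr]; [id] is the last
    affine layer. *)
Fixpoint net (n k : nat) : 'rV[R]_state -> 'rV[R]_1 :=
  if k is k'.+1 then net n k' \o step n
  else id \o @relu R 1 \o (fun z => const_mx (1 - penalty z)).

Let net_ge0 n k z : 0 <= net n k z 0 0.
Proof.
elim: k z => [|k IHk] z /=; last exact: IHk.
by rewrite !mxE; exact: relu1_ge0.
Qed.

(** As penalties never decrease, a penalty of 1 at any stage forces the output 0. *)
Let net_le n k z : net n k z 0 0 <= relu1 (1 - penalty z).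
Proof.
elim: k z => [|k IHk] z /=; first by rewrite !mxE.
apply: (le_trans (IHk _)); apply: le_max2 => //.
by rewrite lerB// penalty_step.
Qed.

Let net_le1 n k x : net n k (mkstate x 0) 0 0 <= 1.
Proof.
by apply: (le_trans (net_le _ _ _)); rewrite penalty_mkstate subr0 relu1_id.
Qed.

Variable U : nat -> set 'rV[R]_d.
Hypothesis U0_in : forall a x, piece a x -> U 0%N (g a x).
Hypothesis US : forall k x, U k.+1 x <-> exists a, piece a x /\ U k (g a x).

(** Without blocks the network makes no membership test, so for k = 0 the point must be known to lie
    in [U 0]. After a passed test [U0_in] provides this, which is why the final result starts at k =
    1. *)
Let net_cvg k z : 0 <= penalty z -> (k = 0%N -> U 0%N (point z)) ->
  \forall n \near \oo, net n k z 0 0 =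
    relu1 (1 - penalty z) * \1_(U k) (point z).
Proof.
elim: k z => [|k IHk] z z0 Uz.
  apply: nearW => m /=; rewrite !mxE indicE mem_set ?mulr1//.
  exact: Uz.
have [[a Qz]|/forallNP Qz] := pselect (exists a, piece a (point z)).
  have -> : \1_(U k.+1) (point z) = \1_(U k) (g a (point z)) :> R.
    rewrite !indicE; congr (nat_of_bool _)%:R; apply/idP/idP; rewrite !inE.
      by move=> /US[b [Qb]]; rewrite (piece_disj Qz Qb).
    by move=> Uk; apply/US; exists a.
  have := IHk (mkstate (g a (point z)) (penalty z)).
  rewrite penalty_mkstate point_mkstate => /(_ z0 (fun _ => U0_in Qz)).
  apply: filterS2 (step_in Qz z0) => m /= -> ->.
  by [].
apply: nearW => m /=; rewrite indicE memNset; last first.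
  by move=> /US[a [Qa _]]; exact: (Qz a).
rewrite mulr0; apply/eqP; rewrite eq_le net_ge0 andbT.
apply: (le_trans (net_le _ _ _)).
by rewrite relu1_eq0// subr_le0 step_out.
Qed.

(** A sum is a convenient upper bound for the maximal layer size; it is independent of n and k. *)
Let width := (1 + d + state + #|H1| + #|H2| + #|H3|)%N.

Let net_repr n k : nn_repr width (3 * k + 1) (net n k).
Proof.
have ws : (state <= width)%N by rewrite /width; lia.
have w1 : (#|H1| <= width)%N by rewrite /width; lia.
have w2 : (#|H2| <= width)%N by rewrite /width; lia.
have w3 : (#|H3| <= width)%N by rewrite /width; lia.
elim: k => [|k IHk].
  apply: nn_repr_relu => //=.
    apply/affine_formP => j; under eq_fun do rewrite mxE.
    by apply: affine_formB; [exact: affine_form_cst|exact: affine_form_entry].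
  by split => //; exists 1%:M, 0 => x; rewrite mulmx1 addr0.
have h4 := nn_repr_comp_affine w3 affine_eta4 IHk.
have h3 := nn_repr_relu w2 w3 (affine_eta3 n) h4.
have h2 := nn_repr_relu w1 w2 affine_eta2 h3.
by rewrite mulnS -addnA; exact: nn_repr_relu ws w1 (affine_eta1 n) h2.
Qed.

Lemma network_indic : exists W : nat, forall k, (1 <= k)%N ->
  exists psi : nat -> 'rV[R]_d -> 'rV[R]_1,
  [/\ forall n, nn_repr W (3 * k + 1) (psi n),
      forall n x, 0 <= psi n x 0 0 <= 1 &
      forall x, \forall n \near \oo, psi n x 0 0 = \1_(U k) x].
Proof.
have dw : (d <= width)%N by rewrite /width; lia.
have affine_init : affine (mkstate^~ 0).
  apply: affine_vec_of => -[i|]; last exact: affine_form_cst.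
  exact: affine_form_coord.
exists width => k k1; exists (fun n x => net n k (mkstate x 0)); split.
- move=> n; exact: nn_repr_comp_affine dw affine_init (net_repr n k).
- by move=> n x; rewrite net_ge0 net_le1.
- move=> x; have := @net_cvg k (mkstate x 0).
  rewrite penalty_mkstate point_mkstate subr0 relu1_id// mul1r; apply => //.
  by case: k k1.
Qed.

End Network.

(** * Bounded convergence in L^p on a set of finite measure *)

Section BoundedConvergence.
Context d (T : measurableType d) (R : realType).
Variables (mu : {measure set T -> \bar R}) (K : set T) (p : R).
Hypotheses (mK : measurable K) (K_fin : (mu K < +oo)%E) (p1 : 1 <= p).

Let p0 : 0 < p. Proof. exact: lt_le_trans p1. Qed.

Let powR_le1 (t : R) : `|t| <= 1 -> `|t| `^ p <= 1.
Proof.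
move=> t1; have := ge0_ler_powR (ltW p0) _ _ t1.
by rewrite powR1; apply; rewrite nnegrE.
Qed.

(** The indicator of [K], integrable since [K] has finite measure, is the dominating function
    below. *)
Let restrict_le1 (h : T -> R) x : (forall x, `|h x| <= 1) ->
  `|(h \_ K) x| `^ p <= \1_K x.
Proof.
move=> h1; rewrite patchE indicE; case: ifPn => _; first exact: powR_le1.
by rewrite normr0 powR0// gt_eqF.
Qed.

Let integrable_indicK : mu.-integrable setT (EFin \o \1_K : T -> \bar R).
Proof.
apply/integrableP; split; first exact/measurable_EFinP/measurable_indic.
under eq_integral do rewrite /= ger0_norm//.
by rewrite integral_indic// setIT.
Qed.

Let measurable_powR_norm (h : T -> R) : measurable_fun setT h ->
  measurable_fun setT (fun x => (`|(h \_ K) x| `^ p)%:E).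
Proof.
move=> mh; apply/measurable_EFinP.
have mhK : measurable_fun setT (h \_ K).
  by apply/(measurable_restrictT _ mK); exact: measurable_funTS.
have := measurableT_comp (@normr_measurable R setT) mhK.
exact: measurableT_comp (measurable_powR p).
Qed.

Lemma Lfun_restrict_le1 (h : T -> R) : measurable_fun setT h ->
  (forall x, `|h x| <= 1) -> (h \_ K) \in Lfun mu p%:E.
Proof.
move=> mh h1; apply/andP; rewrite !inE /=; split.
  by apply/(measurable_restrictT _ mK); exact: measurable_funTS.
rewrite /finite_norm unlock /=; apply: poweR_lty.
apply: (@le_lt_trans _ _ (\int[mu]_x (\1_K x)%:E)%E).
  apply: ge0_le_integral => //=.
  - exact: measurable_powR_norm.
  - exact/measurable_EFinP/measurable_indic.
  - by move=> x _; rewrite lee_fin; exact: restrict_le1.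
by rewrite integral_indic// setIT.
Qed.

Lemma Lnorm_restrict_cvg0 (h : nat -> T -> R) :
  (forall n, measurable_fun setT (h n)) ->
  (forall n x, `|h n x| <= 1) ->
  (forall x, h n x @[n --> \oo] --> 0) ->
  'N[mu]_p%:E[EFin \o (h n \_ K)]%E @[n --> \oo] --> 0%E.
Proof.
move=> mh h1 h0.
have I0 : (\int[mu]_x (`|(h n \_ K) x| `^ p)%:E)%E @[n --> \oo] --> 0%E.
  have cvg0 x : (`|(h n \_ K) x| `^ p)%:E @[n --> \oo] --> 0%E.
    apply: cvg_EFin; first exact: nearW.
    apply/cvgrPdist_le => e e0.
    have ep : 0 < e `^ p^-1 by rewrite powR_gt0.
    move/cvgrPdist_le : (h0 x) => /(_ _ ep); apply: filterS => n.
    rewrite !sub0r !normrN /= (ger0_norm (powR_ge0 _ _)) => hn.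
    have -> : e = (e `^ p^-1) `^ p.
      by rewrite -powRrM mulVf ?gt_eqF// powRr1// ltW.
    rewrite ge0_ler_powR ?nnegrE ?powR_ge0 ?(ltW p0)//.
    rewrite patchE; case: ifPn => // _.
    by rewrite normr0 powR_ge0.
  have dom x n : (`|(`|(h n \_ K) x| `^ p)%:E| <= (EFin \o \1_K) x)%E.
    by rewrite /= lee_fin ger0_norm ?powR_ge0//; exact: restrict_le1.
  have [_ _] := @dominated_convergence _ T R mu setT measurableT
    (fun n x => (`|(h n \_ K) x| `^ p)%:E) (cst 0%E) (EFin \o \1_K)
    (fun n => measurable_powR_norm (mh n)) (measurable_cst _)
    (aeW _ (fun x _ => cvg0 x)) integrable_indicK
    (aeW _ (fun x n _ => dom x n)).
  by rewrite integral0.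
apply/fine_cvgP; split.
  near=> n; rewrite unlock /=; apply: fin_num_poweR.
  have : (\int[mu]_x (`|(h n \_ K) x| `^ p)%:E)%E \is a fin_num.
    by near: n; move/fine_cvgP : I0 => [].
  by [].
apply/cvgrPdist_le => e e0.
(* The norm is the integral raised to the power 1/p, so an integral of at most e^p gives a norm of
   at most e. *)
have ep : 0 < e `^ p by rewrite powR_gt0.
move/fine_cvgP : I0 => [_ /cvgrPdist_le/(_ _ ep)]; apply: filterS => n /=.
rewrite !sub0r !normrN unlock /= fine_poweR => In.
rewrite (ger0_norm (powR_ge0 _ _)).
have -> : e = (e `^ p) `^ p^-1.
  by rewrite -powRrM mulfV ?gt_eqF// powRr1// ltW.
rewrite ge0_ler_powR ?nnegrE ?powR_ge0 ?invr_ge0 ?(ltW p0)//.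
  by apply/fine_ge0/integral_ge0 => x _; rewrite lee_fin powR_ge0.
exact: le_trans (ler_norm _) In.
Unshelve. all: end_near. Qed.

End BoundedConvergence.

(** * Measurability of networks and finite volume of compact sets *)

Section BorelRV.
Variable R : realType.

Lemma measurable_compact_rV d (K : set 'rV[R]_d) : compact K ->
  measurable (K : set (borel_rV R d)).
Proof.
move=> cK; rewrite -[K]setCK; apply: measurableC; apply: measurable_open_rV.
apply: closed_openC; apply: compact_closed cK; exact: norm_hausdorff.
Qed.

Lemma measurable_coord d (j : 'I_d) :
  measurable_fun setT (fun v : borel_rV R d => v 0 j : R).
Proof.
apply: (measurability _ (RGenOpens.measurableE R)).
move=> _ [_ [a [b ->]] <-].
rewrite setTI; apply: measurable_open_rV.
by apply: open_comp; [move=> v _; exact: coord_continuous|exact: interval_open].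
Qed.

(** A compact set is bounded, hence inside an open cube, whose volume [lebesgue_rV_box] computes. *)
Lemma lebesgue_rV_compact_fin d (K : set 'rV[R]_d) : compact K ->
  (lebesgue_rV R d K < +oo)%E.
Proof.
move=> cK; have /ex_strict_bound_gt0[M M0 KM] := compact_bounded cK.
have a_le_b i : (const_mx (- M) : 'rV[R]_d) 0 i <= (const_mx M : 'rV[R]_d) 0 i.
  by rewrite !mxE ge0_cp ?ltW.
have := lebesgue_rV_box a_le_b.
set B := [set v : 'rV[R]_d | _] => BE.
apply: (@le_lt_trans _ _ (lebesgue_rV R d B)); last by rewrite BE ltry.
apply: le_measure.
- by rewrite inE; exact: measurable_compact_rV.
- rewrite inE (_ : B = \bigcap_(i in [set: 'I_d])
      (fun v : 'rV[R]_d => v 0 i) @^-1` `]- M, M[%classic).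
    apply: fin_bigcap_measurable => // i _.
    by rewrite -[X in measurable X]setTI; exact: measurable_coord.
  apply/seteqP; split=> v /= vB i.
    by move=> _; have := vB i; rewrite !mxE /= in_itv.
  by have := vB i I; rewrite /= in_itv !mxE.
- move=> v /KM /= vM i; rewrite !mxE -ltr_norml.
  apply: le_lt_trans vM; rewrite [leRHS]mx_normrE.
  exact: (le_bigmax _ (fun ij : 'I_1 * 'I_d => `|v ij.1 ij.2|) (0, i)).
Qed.

Section nn_measurable.
Context disp (T : measurableType disp).

Let affine_measurable n m (e : 'rV[R]_n -> 'rV[R]_m) (u : T -> 'rV[R]_n) :
  affine e -> (forall i, measurable_fun setT (fun t => u t 0 i)) ->
  forall j, measurable_fun setT (fun t => e (u t) 0 j).
Proof.
move=> [A [b eE]] mu j; under eq_fun do rewrite eE !mxE.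
apply: measurable_funD => //; apply: measurable_sum => i.
exact: measurable_funM.
Qed.

(** The input [u] is arbitrary so that the induction can replace it by the output of the first
    layer; measurability is then handled coordinatewise, for real functions. *)
Lemma nn_repr_measurable w q n m (f : 'rV[R]_n -> 'rV[R]_m)
    (u : T -> 'rV[R]_n) : nn_repr w q f ->
  (forall i, measurable_fun setT (fun t => u t 0 i)) ->
  forall j, measurable_fun setT (fun t => f (u t) 0 j).
Proof.
elim: q => [|q IHq] in n f u *.
  by move=> [_ _ faff] mu; exact: affine_measurable.
move=> [k [e [g [_ _ eaff gnn ->]]]] mu /=.
apply: (IHq _ g (fun t => relu (e (u t)))) => // i.
under eq_fun do rewrite mxE.
by apply: measurable_maxr => //; exact: affine_measurable.
Qed.

End nn_measurable.

Lemma cvg_Lp_le1 d (K : set 'rV[R]_d) (p : R) (u : nat -> 'rV[R]_d -> R)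
    (f : 'rV[R]_d -> R) : compact K -> 1 <= p ->
  (forall n, measurable_fun setT (u n : borel_rV R d -> R)) ->
  (forall n x, 0 <= u n x <= 1) -> (forall x, 0 <= f x <= 1) ->
  (forall x, u n x @[n --> \oo] --> f x) ->
  cvg_Lp K p u f.
Proof.
move=> cK p1 mu u1 f1 uf.
have mK := measurable_compact_rV cK.
have Kfin := lebesgue_rV_compact_fin cK.
(* The limit inherits measurability from the pointwise convergence. *)
have mf : measurable_fun setT (f : borel_rV R d -> R).
  exact: (measurable_fun_cvg (h := (u : nat -> borel_rV R d -> R))).
have norm1 (t : R) : 0 <= t <= 1 -> `|t| <= 1.
  by move=> /andP[t0 t1]; rewrite ger0_norm.
split.
- by move=> n; apply: Lfun_restrict_le1 => // x; exact: norm1.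
- by apply: Lfun_restrict_le1 => // x; exact: norm1.
- apply: (Lnorm_restrict_cvg0 (T := borel_rV R d)) => //.
  + by move=> n; apply: measurable_funB.
  + move=> n x /=; move: (u1 n x) (f1 x) => /andP[u0 ?] /andP[f0 ?].
    by rewrite ler_norml; lra.
  + by move=> x; rewrite -(subrr (f x)); apply: cvgB => //; exact: cvg_cst.
Qed.

End BorelRV.

(** * Polytopes as affine inequalities, and inverses of affine maps *)

Lemma open_halfspace_affine_form (R : realType) (d : nat)
    (H : set 'rV[R]_d) : open_halfspace H ->
  exists2 h : 'rV[R]_d -> R, affine_form h & H = [set x | 0 < h x].
Proof.
move=> [a [c [_ ->]]]; exists (fun x => c - (x *m a) 0 0).
  apply: affine_formB; first exact: affine_form_cst.
  by exists a, 0 => x; rewrite addr0.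
by apply/seteqP; split => x /=; rewrite subr_gt0.
Qed.

(** Indexing the forms by [nat] and cutting off at [h] gives them a type independent of [h], so that
    [choice] applies to a family of polytopes. *)
Lemma open_polytope_affine_forms (R : realType) (d : nat)
    (P : set 'rV[R]_d) : open_polytope P ->
  exists (h : nat) (l : nat -> 'rV[R]_d -> R),
    (forall i, affine_form (l i)) /\ P = [set x | forall i : 'I_h, 0 < l i x].
Proof.
move=> [_ [h [H [Hhalf ->]]]].
have Hl i : exists l, affine_form l /\ H i = [set x | 0 < l x].
  by have [l] := open_halfspace_affine_form (Hhalf i); exists l.
have /choice[l lP] := Hl.
(* The constant 1 is a dummy affine form for indices beyond [h]. *)
exists h, (fun i => if insub i is Some j then l j else fun=> 1); split.
  move=> i; case: insubP => [j _ _|_]; first exact: (lP j).1.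
  exact: affine_form_cst.
apply/seteqP; split => x /= Hx i.
  by rewrite valK; have := Hx i I; rewrite (lP i).2.
by move=> _; have := Hx i; rewrite valK (lP i).2.
Qed.

Lemma invertible_affine_inv (R : realType) (d : nat)
    (f : 'rV[R]_d -> 'rV[R]_d) : invertible_affine f ->
  exists g, [/\ affine g, cancel f g & cancel g f].
Proof.
move=> [A [b [Au fE]]]; exists (fun y => (y - b) *m invmx A); split.
- by exists (invmx A), (- b *m invmx A) => x; rewrite mulmxDl.
- by move=> x; rewrite fE addrK mulmxK.
- by move=> y; rewrite fE mulmxKV// subrK.
Qed.

(** * The network applied to the iterated function system *)

Theorem theorem2 (R : realType) (d J : nat)
    (f : 'I_J -> 'rV[R]_d -> 'rV[R]_d) (U0 : set 'rV[R]_d)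
    (hF : ifs f) (hopen : open U0) (hnice : nice f U0)
    (hU0 : exists (m : nat) (P : 'I_m -> set 'rV[R]_d),
      [/\ forall i, open_polytope (P i),
          trivIset [set: 'I_m] P &
          U0 = \bigcup_i P i])
    (haff : forall j, invertible_affine (f j)) :
  exists W0 L0 : nat, forall k : nat, (1 <= k)%N ->
    exists psi : nat -> 'rV[R]_d -> 'rV[R]_1,
      let Uk := iter k (hutchinson f) U0 in
      [/\ forall n, NNF W0 (L0 * k + 1) (psi n),
          forall x, psi n x 0 0 @[n --> \oo] --> (\1_Uk x : R) &
          forall (K : set 'rV[R]_d) (p : R), compact K -> 1 <= p ->
            cvg_Lp K p (fun n x => psi n x 0 0) \1_Uk].
Proof.
have [m [P [Ppoly Pdisj U0E]]] := hU0.
have [_ fU0 fdisj] := hnice.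
have /choice[g gP] := fun j => invertible_affine_inv (haff j).
have /choice[h /choice[l lP]] := fun i => open_polytope_affine_forms (Ppoly i).
pose A := ('I_J * 'I_m)%type.
(* The inequalities of P_i pulled back along the inverse of f_j cut out f_j P_i. *)
pose l' (a : A) (i : 'I_(h a.2)) x := l a.2 i (g a.1 x).
have pieceE (a : A) x : (forall i, 0 < @l' a i x) <-> P a.2 (g a.1 x).
  by rewrite (lP a.2).2.
have l'_affine a i : affine_form (@l' a i).
  have [gaff _ _] := gP a.1.
  exact: affine_form_comp ((lP a.2).1 i) gaff.
have PU0 i x : P i x -> U0 x by rewrite U0E; exists i.
(* Such an x lies in both f_j U_0 and f_j' U_0, which are disjoint for distinct indices. *)
have g_inj j j' x : U0 (g j x) -> U0 (g j' x) -> j = j'.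
  move=> Uj Uj'; apply: contrapT => /eqP /fdisj/seteqP[/(_ x) + _]; apply.
  have [_ _ gK] := gP j; have [_ _ gK'] := gP j'.
  by split; [exists (g j x)|exists (g j' x)].
have pieceU0 (a : A) x : (forall i, 0 < @l' a i x) -> U0 (g a.1 x).
  by move=> /pieceE /PU0.
have piece_disj (a b : A) x : (forall i, 0 < @l' a i x) ->
    (forall i, 0 < @l' b i x) -> a = b.
  move=> Qa Qb; case: a b Qa Qb => [j i] [j' i'] Qa Qb.
  have /= jj' := g_inj _ _ _ (pieceU0 _ _ Qa) (pieceU0 _ _ Qb).
  have := (pieceE _ _).1 Qb; have /= Pa := (pieceE _ _).1 Qa.
  rewrite /= -jj' => Pb.
  by rewrite (Pdisj i i' I I)//; exists (g j x).
(* This places a preimage y in U_k inside some P_i, as the recursion [US] requires. *)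
have UkU0 k : iter k (hutchinson f) U0 `<=` U0.
  elim: k => // k IHk x /= [j _ [y /IHk U0y <-]].
  by apply: (fU0 j); exists y.
have US k x : iter k.+1 (hutchinson f) U0 x <->
    exists a : A, (forall i, 0 < @l' a i x) /\
                  iter k (hutchinson f) U0 (g a.1 x).
  split=> [/= [j _ [y Uy <-]]|[[j i] [_ Uk]]].
    have [_ fK _] := gP j.
    have [i _ Piy] : (\bigcup_i P i) y by rewrite -U0E; exact: UkU0 Uy.
    by exists (j, i); split; [apply/pieceE|]; rewrite /= fK.
  have [_ _ gK] := gP j.
  by exists j => //; exists (g j x).
have g_affine (a : A) : affine (g a.1) by have [] := gP a.1.
have [W WP] := network_indic l'_affine g_affine piece_disj pieceU0 US.
(* Three ReLU layers per block; the additional one is the output ReLU. *)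
exists W, 3 => k k1; have [psi [psinn psi01 psiU]] := WP k k1.
have psi_cvg x : psi n x 0 0 @[n --> \oo] -->
    (\1_(iter k (hutchinson f) U0) x : R).
  exact: cvg_near_cst.
exists psi => Uk; split=> //.
  by move=> n; exists (3 * k + 1)%N.
move=> K p cK p1; apply: cvg_Lp_le1 => //.
- move=> n; apply: (nn_repr_measurable (psinn n)) => i.
  exact: measurable_coord.
- by move=> x; rewrite indicE; case: (_ \in _); rewrite lexx ler01.
Qed.
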